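(* Let $(R,\mathfrak m,k)$ be a Noetherian (standard graded) local ring with infinite residue field $k$ and $\mathfrak m^2\neq0$, and let $r$ be a non-negative integer. If $\mu(\mathfrak m^2)<\binom{r+2}{r}$, then $\operatorname{ms}(R)\le r$. In particular, if $\mu(\mathfrak m^2)\le2$, then $\operatorname{ms}(R)=1$.
   Context: All rings are commutative with unity. A ''Noetherian (standard graded) local ring $(R,\mathfrak m)$'' means either a Noetherian local ring with maximal ideal $\mathfrak m$, or a Noetherian standard graded ring $R=\bigoplus_{i\ge 0}R_i$ with $R_0$ a field, $R=R_0[R_1]$ and $\mathfrak m=\bigoplus_{i\ge1}R_i$; ''(homogeneous)'' applies in the graded case. Put $k=R/\mathfrak m$ and $\mu(I)=\dim_k(I/\mathfrak m I)$, the minimal number of generators of a (homogeneous) ideal $I$. Define $$\operatorname{ms}(R)=\min\{\mu(I): I\subseteq \mathfrak m \text{ a (homogeneous) ideal with } I\supseteq \mathfrak m^2\}.$$ *)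

(* Defs.v *)
From HB Require Import structures.
From mathcomp Require Import all_boot all_order all_algebra.
From mathcomp Require Import ring_quotient generic_quotient.
From mathcomp Require Import boolp classical_sets functions cardinality.

Set Implicit Arguments.
Unset Strict Implicit.
Unset Printing Implicit Defensive.

Import GRing.Theory.
Local Open Scope ring_scope.
Local Open Scope quotient_scope.

(* Ideals are MathComp's [idealr R]: proper ideals, given as boolean
   predicates.  Classically every set is such a predicate (see [asbool]), and
   all ideals needed here are contained in the maximal ideal, hence proper. *)

Section IdealProduct.
Variables (R : comNzRingType) (I J : idealr R).

Definition idealM : {pred R} := fun x =>
  `[< exists n (a b : 'I_n -> R),
        [/\ forall i, a i \in I, forall i, b i \in J
          & x = \sum_(i < n) a i * b i] >].

Lemma idealM_sub : {subset idealM <= J}.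
Proof.
move=> x /asboolP[n [a [b [_ Jb ->]]]].
by apply: rpred_sum => i _; apply: idealMr.
Qed.

Lemma idealM_closed : idealr_closed idealM.
Proof.
split.
- apply/asboolP; exists 0, (fun=> 0), (fun=> 0).
  by rewrite big_ord0; split=> // i; apply: rpred0.
- by apply/negP => /idealM_sub; rewrite idealr1.
- move=> c _ _ /asboolP[n [a [b [Ia Jb ->]]]] /asboolP[p [a' [b' [Ia' Jb' ->]]]].
  apply/asboolP; exists (n + p)%N.
  exists (fun i => match fintype.split i with inl j => c * a j | inr j => a' j end).
  exists (fun i => match fintype.split i with inl j => b j | inr j => b' j end).
  split=> [i|i|].
  + by case: (fintype.split i) => j //; apply: idealMr.
  + by case: (fintype.split i).
  + rewrite big_split_ord /= mulr_sumr; congr (_ + _); apply: eq_bigr => i _.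
    * by rewrite (unsplitK (inl i)) mulrA.
    * by rewrite (unsplitK (inr i)).
Qed.

HB.instance Definition _ := isIdealr.Build R idealM idealM_closed.

End IdealProduct.

Section NoetherianLocal.
Variable R : comNzRingType.

(* The unit ideal, which is not an [idealr], is generated by 1. *)
Definition noetherian : Prop :=
  forall I : idealr R, exists n (x : 'I_n -> R),
    forall y, y \in I <-> exists a : 'I_n -> R, y = \sum_(i < n) a i * x i.

Definition maximal_ideal (m : idealr R) : Prop :=
  forall J : idealr R, {subset m <= J} -> J =i m.

Definition local_at (m : idealr R) : Prop :=
  maximal_ideal m /\ forall m' : idealr R, maximal_ideal m' -> m' =i m.

End NoetherianLocal.

Record std_grading (R : comNzRingType) := StdGrading {
  piece :> nat -> zmodClosed R;
  piece_span : forall x : R, exists n (f : nat -> R),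
    (forall i, f i \in piece i) /\ x = \sum_(i < n) f i;
  piece_free : forall n (f : nat -> R), (forall i, f i \in piece i) ->
    \sum_(i < n) f i = 0 -> forall i, (i < n)%N -> f i = 0;
  piece_one : 1 \in piece 0%N;
  pieceM : forall i j x y,
    x \in piece i -> y \in piece j -> x * y \in piece (i + j)%N;
  piece0_field : forall x, x \in piece 0%N -> x != 0 ->
    exists2 y, y \in piece 0%N & x * y = 1;
  (* R = R_0[R_1] *)
  piece_gen : forall S : subringClosed R,
    {subset piece 0%N <= S} -> {subset piece 1%N <= S} -> forall x, x \in S
}.

Section Graded.
Variables (R : comNzRingType) (G : std_grading R).

Definition homogeneous (I : idealr R) : Prop :=
  forall n (f : nat -> R), (forall i, f i \in G i) ->
    \sum_(i < n) f i \in I -> forall i, (i < n)%N -> f i \in I.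

Lemma sum_trunc (u : nat -> R) q N : (q <= N)%N ->
  \sum_(i < N) (if (i < q)%N then u i else 0) = \sum_(i < q) u i.
Proof.
move=> qN; rewrite (big_ord_widen_cond N xpredT u) //.
by rewrite [RHS]big_mkcond.
Qed.

(* m = R_1 + R_2 + ... *)
Definition irrelevant : {pred R} := fun x =>
  `[< exists n (f : nat -> R),
        (forall i, f i \in G i.+1) /\ x = \sum_(i < n) f i >].

Lemma irrelevantP0 n (f : nat -> R) :
  (forall i, f i \in G i) -> \sum_(i < n.+1) f i \in irrelevant -> f 0%N = 0.
Proof.
move=> Gf /asboolP[p [g [Gg fg]]].
pose h i := (if (i < n.+1)%N then f i else 0)
          - (if i is j.+1 then if (j < p)%N then g j else 0 else 0).
have Gh i : h i \in G i.
  by apply: rpredB; [case: ifP | case: i => [|j] //; [|case: ifP]];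
    rewrite ?rpred0.
have h0 : \sum_(i < (n + p).+1) h i = 0.
  rewrite /h big_split /= sumrN (@sum_trunc _ n.+1) ?ltnS ?leq_addr //.
  by rewrite [X in _ - X]big_ord_recl add0r /= (@sum_trunc g p) ?leq_addl // fg subrr.
by have := piece_free Gh h0 (ltn0Sn _); rewrite /h /= subr0.
Qed.

Lemma irrelevant_piece i x : x \in G i.+1 -> x \in irrelevant.
Proof.
move=> Gx; apply/asboolP; exists i.+1, (fun j => if j == i then x else 0).
split=> [j|]; first by case: eqP => [->|_] //; apply: rpred0.
rewrite big_ord_recr /= eqxx big1 ?add0r // => j _.
by rewrite ltn_eqF.
Qed.

Lemma irrelevantD : {in irrelevant &, forall x y, x + y \in irrelevant}.
Proof.
move=> _ _ /asboolP[n [f [Gf ->]]] /asboolP[p [g [Gg ->]]].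
apply/asboolP; exists (n + p)%N.
exists (fun i => (if (i < n)%N then f i else 0)
               + (if (i < p)%N then g i else 0)); split=> [i|].
  by apply: rpredD; case: ifP; rewrite ?rpred0.
by rewrite big_split /= (@sum_trunc _ n) ?leq_addr // (@sum_trunc _ p) ?leq_addl.
Qed.

Lemma irrelevant0 : 0 \in irrelevant.
Proof.
by apply/asboolP; exists 0, (fun=> 0); rewrite big_ord0; split=> // i;
  apply: rpred0.
Qed.

Lemma irrelevant_closed : idealr_closed irrelevant.
Proof.
split; first exact: irrelevant0.
- apply/negP => m1; pose f i : R := if i is 0%N then 1 else 0.
  have Gf i : f i \in G i by case: i => [|i]; rewrite ?piece_one ?rpred0.
  have : \sum_(i < 1) f i \in irrelevant by rewrite big_ord1.
  by move/(irrelevantP0 Gf) => /eqP; rewrite oner_eq0.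
- move=> c _ y /asboolP[n [f [Gf ->]]] my.
  apply: irrelevantD => //; have [p [g [Gg ->]]] := piece_span G c.
  rewrite mulr_sumr.
  apply: (big_ind (fun z => z \in irrelevant)) => [||i _];
    [exact: irrelevant0 | exact: irrelevantD |].
  rewrite mulr_suml.
  apply: (big_ind (fun z => z \in irrelevant)) => [||j _];
    [exact: irrelevant0 | exact: irrelevantD |].
  by apply: (@irrelevant_piece (j + i)); rewrite -addnS pieceM.
Qed.

HB.instance Definition _ := isIdealr.Build R irrelevant irrelevant_closed.

Lemma homogeneous_irrelevant : homogeneous irrelevant.
Proof.
move=> [|n] // f Gf mf [_|i _]; last exact: irrelevant_piece (Gf _).
by rewrite (irrelevantP0 Gf mf) rpred0.
Qed.

End Graded.

(* The two meanings of "(standard graded) local ring". *)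
Inductive local_or_graded (R : comNzRingType) :=
| LocalCase (m : idealr R) of local_at m
| GradedCase of std_grading R.

Section LocalOrGraded.
Variables (R : comNzRingType) (L : local_or_graded R).

Definition maxid : idealr R :=
  match L with LocalCase m _ => m | GradedCase G => irrelevant G end.

(* "(homogeneous) ideal" *)
Definition admissible (I : idealr R) : Prop :=
  match L with LocalCase _ _ => True | GradedCase G => homogeneous G I end.

Lemma admissible_maxid : admissible maxid.
Proof.
by rewrite /admissible /maxid; case: L => // G; apply: homogeneous_irrelevant.
Qed.

Definition residue_field := {ideal_quot maxid}.
HB.instance Definition _ := GRing.ComNzRing.on residue_field.

End LocalOrGraded.

Section Fiber.
Variables (R : comNzRingType) (L : local_or_graded R) (I : idealr R).
Let m := maxid L.

Record ideal_elt := IdealElt { ideal_val : R; _ : ideal_val \in I }.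
HB.instance Definition _ := [isSub for ideal_val].
HB.instance Definition _ := [Choice of ideal_elt by <:].
HB.instance Definition _ := [SubChoice_isSubZmodule of ideal_elt by <:].

Definition mI_pred : {pred ideal_elt} := fun x => val x \in idealM m I.

Lemma mI_closed : zmod_closed mI_pred.
Proof.
split; first by rewrite unfold_in raddf0 rpred0.
by move=> x y mx my; rewrite unfold_in raddfB rpredB.
Qed.

HB.instance Definition _ := GRing.isZmodClosed.Build ideal_elt mI_pred mI_closed.

(* I / mI *)
Definition fiber := Quotient.quot mI_pred.
HB.instance Definition _ := GRing.Zmodule.on fiber.

Definition ideal_scale (a : R) (x : ideal_elt) : ideal_elt :=
  IdealElt (idealMr a (valP x)).

Definition fiber_scale (a : residue_field L) (v : fiber) : fiber :=
  \pi_fiber (ideal_scale (repr a) (repr v)).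

Lemma idealM_in a x : a \in m -> x \in I -> a * x \in idealM m I.
Proof.
move=> ma Ix; apply/asboolP; exists 1%N, (fun=> a), (fun=> x).
by rewrite big_ord1.
Qed.

Lemma fiber_eq (x y : ideal_elt) :
  (\pi_fiber x = \pi_fiber y) <-> val x - val y \in idealM m I.
Proof.
rewrite -raddfB; change (\pi_fiber x = \pi_fiber y <-> x - y \in mI_pred).
by rewrite Quotient.idealrBE; split=> /eqP.
Qed.

Lemma pi_val (x y : ideal_elt) :
  ideal_val x = ideal_val y -> \pi_fiber x = \pi_fiber y.
Proof. by move/val_inj->. Qed.

Lemma fiber_scaleE (a : R) (x : ideal_elt) :
  fiber_scale (\pi_(residue_field L) a) (\pi_fiber x)
  = \pi_fiber (ideal_scale a x).
Proof.
apply/fiber_eq => /=.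
set a' := repr _; set x' := repr _.
have ma : a' - a \in m.
  by rewrite (Quotient.idealrBE m) reprK.
have mx : val x' - val x \in idealM m I by apply/fiber_eq; rewrite reprK.
have -> : a' * val x' - a * val x
  = (a' - a) * val x' + a * (val x' - val x).
  by rewrite mulrBl mulrBr addrA subrK.
by apply: rpredD; [apply: idealM_in => //; apply: valP | apply: idealMr].
Qed.

Lemma fiber_scaleA a b v :
  fiber_scale a (fiber_scale b v) = fiber_scale (a * b) v.
Proof.
rewrite -[a]reprK -[b]reprK -[v]reprK -rmorphM.
rewrite [fiber_scale _ (\pi _)]fiber_scaleE !fiber_scaleE.
by apply: pi_val; rewrite /= mulrA.
Qed.

Lemma fiber_scale1 : left_id 1 fiber_scale.
Proof.
move=> v; rewrite -[v]reprK -(rmorph1 (\pi_(residue_field L))) fiber_scaleE.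
by apply: pi_val; rewrite /= mul1r.
Qed.

Lemma fiber_scaleDr : right_distributive fiber_scale +%R.
Proof.
move=> a v w; rewrite -[a]reprK -[v]reprK -[w]reprK -raddfD !fiber_scaleE.
by rewrite -raddfD; apply: pi_val; rewrite /= mulrDr.
Qed.

Lemma fiber_scaleDl v : {morph fiber_scale^~ v : a b / a + b}.
Proof.
move=> a b; rewrite -[a]reprK -[b]reprK -[v]reprK -raddfD !fiber_scaleE.
by rewrite -raddfD; apply: pi_val; rewrite /= mulrDl.
Qed.

HB.instance Definition _ := GRing.Zmodule_isLmodule.Build
  (residue_field L) fiber fiber_scaleA fiber_scale1 fiber_scaleDr fiber_scaleDl.

(* mu(I) = dim_k (I / mI).  [Vector.axiom n V] says that V is linearly
   isomorphic to the row vectors k^n.  The default value 0 is taken only when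
   the dimension is infinite, which never happens in a noetherian ring. *)
Definition mu : nat :=
  xget 0%N [set n | inhabited (Vector.axiom n fiber)].

End Fiber.

Section Ms.
Variables (R : comNzRingType) (L : local_or_graded R).
Let m := maxid L.

Definition ms_candidate : pred nat := fun n =>
  `[< exists I : idealr R,
        [/\ admissible L I, {subset I <= m}, {subset idealM m m <= I}
          & n = mu L I] >].

Lemma ms_candidate_ex : exists n, ms_candidate n.
Proof.
exists (mu L m); apply/asboolP; exists m; split=> //.
- exact: admissible_maxid.
- exact: idealM_sub.
Qed.

Definition ms : nat := ex_minn ms_candidate_ex.

End Ms.

(* Main.v *)
(** Modulo [m m^2], multiplication of linear forms is a symmetric bilinear map
    [V x V -> m^2/m^3] with spanning image [S]. As in the theorem of Eakin and
    Sathaye, some [r] linear forms [y_i] satisfy [y_1 V + ... + y_r V = S] as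
    soon as [dim S < 'C(r + 2, 2)]. By induction on [r] this reduces to the
    quadratic case of Green's restriction theorem: if [l] is a linear form for
    which multiplication [V -> S] has maximal rank [s], suitably chosen, then
    [dim (S / l V) <= 'C(s, 2)], because [ker l] multiplies [V] into [l V].
    By Nakayama's lemma [I = (y_1, ..., y_r)] contains [m^2]. In the graded case
    the [y_i] can be taken of degree 1, so that [I] is homogeneous. *)

From HB Require Import structures.
Require Import Defs.
From mathcomp Require Import all_boot all_order all_algebra.
From mathcomp Require Import ring_quotient generic_quotient.
From mathcomp Require Import boolp classical_sets functions cardinality.
From mathcomp Require Import zify ring.

Set Implicit Arguments.
Unset Strict Implicit.
Unset Printing Implicit Defensive.

Import GRing.Theory.
Local Open Scope ring_scope.
Local Open Scope quotient_scope.

(** * Symmetric bilinear maps over an infinite field *)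

(** If [C] is a right inverse of [A], then [\det ((A + t *: B) *m C)] is a polynomial in [t] with
    value 1 at 0. Wherever it is nonzero, the pencil is row free. *)
Lemma row_free_pencil (K : fieldType) m n (A B : 'M[K]_(m, n)) : row_free A ->
  exists2 q : {poly K}, q != 0 & forall t, ~~ root q t -> row_free (A + t *: B).
Proof.
case/row_freeP=> C AC1.
pose Q : 'M[{poly K}]_m := 1%:M + 'X *: map_mx polyC (B *m C).
have detQ t : (\det Q).[t] = \det ((A + t *: B) *m C).
  rewrite -[LHS]/(horner_eval t (\det Q)) -det_map_mx; congr (\det _).
  rewrite mulmxDl AC1 -scalemxAl /Q map_mxD map_mx1 map_mxZ.
  by congr (_ + _); apply/matrixP=> i j; rewrite !mxE /= /horner_eval hornerX hornerC.
exists (\det Q) => [|t].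
  apply: contraTneq (oner_neq0 K) => Q0.
  by move: (detQ 0); rewrite Q0 horner0 scale0r addr0 AC1 det1 => <-; rewrite negbK.
rewrite rootE detQ => nz; apply/row_freeP.
have u : (A + t *: B) *m C \in unitmx by rewrite unitmxE unitfE.
by exists (C *m invmx ((A + t *: B) *m C)); rewrite mulmxA mulmxV.
Qed.

Section Quadratic.
Variable K : fieldType.
Hypothesis Kinf : forall q : {poly K}, q != 0 -> exists t, ~~ root q t.

(** [M v] encodes multiplication by [v]: [u *m M v] is the product of [u] and [v], and the row space
    of [M v] is [v V]. For linear [M] this is the space [S] spanned by all products. *)
Definition span_mx N d (M : 'rV[K]_N -> 'M[K]_(N, d)) : 'M[K]_d :=
  (\sum_i <<M (delta_mx 0 i)>>)%MS.

Section Fixed.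
Variables (N d : nat) (M : {linear 'rV[K]_N -> 'M[K]_(N, d)}).
Hypothesis Msym : forall u v, u *m M v = v *m M u.

Lemma span_mx_sub v : (M v <= span_mx M)%MS.
Proof.
rewrite [v]row_sum_delta linear_sum summx_sub // => i _.
rewrite linearZ scalemx_sub // (sumsmx_sup i) // genmxE //.
Qed.


Lemma rowsub_linear p (f : 'I_p -> 'I_N) t u v :
  rowsub f (M u) + t *: rowsub f (M v) = rowsub f (M (u + t *: v)).
Proof. by apply/matrixP=> i j; rewrite linearD linearZ !mxE. Qed.

(** Products with [X] vanish, so only products of rows of [Y] survive: by symmetry, ['C(p, 2)] mixed
    ones and [p] squares. The squares are counted apart because they vanish in one application. *)
Lemma rank_span_le (X : 'M[K]_N) p (Y : 'M_(p, N)) :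
  (forall u : 'rV_N, (u <= X)%MS -> M u = 0) -> (1%:M <= X + Y)%MS ->
  (\rank (span_mx M) <= 'C(p, 2) + \sum_i \rank (row i Y *m M (row i Y)))%N.
Proof.
move=> MX XY1; pose P i j := row i Y *m M (row j Y).
pose T := (\sum_(i < p) (\sum_(j < p | (j < i)%N) <<P i j>>) + \sum_i <<P i i>>)%MS.
have PT i j : (P i j <= T)%MS.
  have lt_case (a b : 'I_p) : (a < b)%N -> (P b a <= T)%MS.
    move=> lt_ab; rewrite /T (submx_trans _ (addsmxSl _ _)) //.
    by rewrite (sumsmx_sup b) // (sumsmx_sup a) // genmxE.
  case: (ltngtP i j) => [lt_ij|lt_ji|/val_inj->].
  - by rewrite /P Msym lt_case.
  - exact: lt_case.
  - by rewrite (submx_trans _ (addsmxSr _ _)) // (sumsmx_sup j) // genmxE.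
have dec (v : 'rV_N) : exists c : 'rV_p, M v = \sum_i c 0 i *: M (row i Y).
  have /sub_addsmxP[[a b] /= ->] : (v <= X + Y)%MS.
    exact: submx_trans (submx1 v) XY1.
  exists b; rewrite linearD /= MX ?submxMl // add0r mulmx_sum_row linear_sum.
  by apply: eq_bigr => i _; rewrite linearZ.
have spanT : (span_mx M <= T)%MS.
  apply/sumsmx_subP=> i _; rewrite genmxE; apply/row_subP=> j.
  rewrite rowE; have [c ->] := dec (delta_mx 0 i).
  rewrite mulmx_sumr summx_sub // => k _; rewrite -scalemxAr scalemx_sub //.
  rewrite Msym; have [c' ->] := dec (delta_mx 0 j).
  rewrite mulmx_sumr summx_sub // => l _; rewrite -scalemxAr scalemx_sub //.
  exact: PT.
apply: leq_trans (mxrankS spanT) _; apply: leq_trans (mxrank_adds_leqif _ _).1 _.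
apply: leq_add; last first.
  apply: leq_trans (mxrank_sum_leqif _).1 _ => /=.
  by apply: leq_sum => i _; rewrite genmxE.
rewrite -bin2_sum big_mkord.
apply: leq_trans (mxrank_sum_leqif _).1 _ => /=; apply: leq_sum => i _.
apply: leq_trans (_ : \sum_(j < p | (j < i)%N) 1 <= _)%N.
  by apply: leq_sum => j _; rewrite genmxE rank_leq_row.
by rewrite (big_ord_narrow (ltnW (ltn_ord i))) sum1_card card_ord.
Qed.

(* Perturb [M l] to [M l + t M w] with [t != 0]: its row space contains
   [t u M w], so a vector outside of the row space of [M l] would make the
   rank grow for generic [t]. *)
Lemma max_rank_ker l (u w : 'rV_N) :
  (forall v, \rank (M v) <= \rank (M l))%N -> u *m M l = 0 -> (u *m M w <= M l)%MS.
Proof.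
move=> maxl uMl; apply: contraT => nsub.
set f := maxrankfun (M l); set A := col_mx (rowsub f (M l)) (u *m M w).
have freeA : row_free A.
  rewrite /row_free eqn_leq rank_leq_row /= -addsmxE.
  rewrite (adds_eqmx (eq_maxrowsub (M l)) (eqmx_refl _)).
  rewrite addn1; apply: rank_ltmx; rewrite ltmxE addsmxSl /=.
  by rewrite addsmx_sub submx_refl.
(* The zero block keeps the last row [u *m M w] fixed along the pencil. Below, the factor ['X]
   ensures that [t] is invertible. *)
have [q q0 qP] := row_free_pencil (col_mx (rowsub f (M w)) 0) freeA.
have [|t] := Kinf (q := 'X * q); first by rewrite mulf_neq0 ?polyX_eq0.
rewrite rootM negb_or rootX => /andP[t0 /qP].
rewrite scale_col_mx add_col_mx scaler0 addr0 => /eqP free.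
suff: (\rank (M l) < \rank (M (l + t *: w)%R))%N by rewrite ltnNge maxl.
rewrite -addn1 -free mxrankS // col_mx_sub; apply/andP; split.
  by rewrite rowsub_linear; apply/row_subP=> i; rewrite row_rowsub row_sub.
have -> : u *m M w = t^-1 *: u *m M (l + t *: w).
  rewrite linearD linearZ /= mulmxDr -scalemxAl uMl scaler0 add0r.
  by rewrite -scalemxAl -scalemxAr scalerA mulVf // scale1r.
exact: submxMl.
Qed.

(** Rank-nullity for [cokermx (M l)] on the span: the part that it kills contains the row space of
    [M l]. *)
Lemma rank_span_coker l :
  (\rank (span_mx (fun v => M v *m cokermx (M l))) + \rank (M l)
     <= \rank (span_mx M))%N.
Proof.
set C := cokermx _; rewrite -(mxrank_mul_ker (span_mx M) C); apply: leq_add.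
  apply/mxrankS/sumsmx_subP=> i _; rewrite genmxE submxMr //.
  exact: span_mx_sub.
by apply: mxrankS; rewrite sub_capmx span_mx_sub; apply/sub_kermxP/mulmx_coker.
Qed.

End Fixed.

Section Exists.
Variables (N d : nat) (M : {linear 'rV[K]_N -> 'M[K]_(N, d)}).
Hypothesis Msym : forall u v, u *m M v = v *m M u.

(* If [l *m M l] is nonzero for some [l] of maximal rank [s], then [ker (M l)]
   and [l] span a space of codimension less than [s] that multiplies everything
   into the row space of [M l]. Otherwise all squares vanish modulo that row
   space, as one sees by perturbing [l]. *)
Lemma exists_rank_coker_le :
  exists l, (\rank (span_mx (fun v => M v *m cokermx (M l)))
               <= 'C(\rank (M l), 2))%N.
Proof.
have [s [[l rl] smax]] : exists s, (exists l, \rank (M l) = s) /\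
    forall v, (\rank (M v) <= s)%N.
  have ubd s : `[< exists l, \rank (M l) = s >] -> (s <= d)%N.
    by case/asboolP=> l <-; apply: rank_leq_col.
  have ex0 : exists s, `[< exists l, \rank (M l) = s >].
    by exists (\rank (M 0)); apply/asboolP; exists 0.
  case: (ex_maxnP ex0 ubd) => s /asboolP sP smax.
  by exists s; split=> // v; apply: smax; apply/asboolP; exists v.
have maxP l' : \rank (M l') = s -> forall v, (\rank (M v) <= \rank (M l'))%N.
  by move->.
have kerP l' u : \rank (M l') = s -> u *m M l' = 0 -> M u *m cokermx (M l') = 0.
  move=> /maxP maxl' ul'; apply/row_matrixP=> i; rewrite row0 row_mul rowE Msym.
  by apply/eqP; rewrite -submxE max_rank_ker.
pose MC l' : {linear 'rV_N -> 'M_(N, d)} := (mulmxr (cokermx (M l')) \o M).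
have MCsym l' u v : u *m MC l' v = v *m MC l' u.
  by rewrite /= !mulmxA Msym.
have full (X : 'M[K]_N) : (1%:M <= X + row_base X^C)%MS.
  have := addsmx_compl_full X; rewrite -sub1mx => /submx_trans-> //.
  by rewrite addsmxS // eq_row_base.
have rkC (X : 'M[K]_N) : \rank X^C%MS = (N - \rank X)%N by rewrite mxrank_compl.
have sN : (s <= N)%N by rewrite -rl rank_leq_row.
case: (pselect (exists2 l', \rank (M l') = s & l' *m M l' != 0)) => [[l' rl' l'l']|sq0].
  exists l'; pose X := (kermx (M l') + <<l'>>)%MS.
  have XM u : (u <= X)%MS -> MC l' u = 0.
    case/sub_addsmxP=> -[a b] /= ->; rewrite linearD mulmxDl /=.
    rewrite kerP // ?add0r; last by rewrite -mulmxA mulmx_ker mulmx0.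
    have : (b *m <<l'>> <= l')%MS by rewrite (submx_trans (submxMl _ _)) ?genmxE.
    by case/sub_rVP=> c ->; rewrite linearZ -scalemxAl mulmx_coker scaler0.
  (* [kermx (M l')] has rank [N - s] and does not contain [l'], so adjoining [l'] leaves a
     complement of rank at most [s - 1]. *)
  have rX : (\rank X^C%MS < s)%N.
    rewrite rkC.
    have : (\rank (kermx (M l')) < \rank X)%N.
      apply: rank_ltmx; rewrite ltmxE addsmxSl /= addsmx_sub submx_refl genmxE /=.
      by rewrite sub_kermx.
    rewrite mxrank_ker rl'; have := rank_leq_row X; lia.
  rewrite rl'.
  rewrite -[span_mx _]/(span_mx (MC l')).
  apply: leq_trans (rank_span_le (MCsym l') XM (full X)) _.
  (* With [p < s] the rank of the complement, the [p] squares cost at most one dimension each, and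
     ['C(p, 2) + p = 'C(p + 1, 2)]. *)
  apply: leq_trans (_ : 'C((\rank X^C%MS).+1, 2) <= _)%N; last exact: leq_bin2l.
  rewrite binS bin1 leq_add2l -[leqRHS]card_ord -sum1_card.
  by apply: leq_sum => i _; apply: rank_leq_row.
have {}sq0 l' : \rank (M l') = s -> l' *m M l' = 0.
  by move=> rl'; apply: contrapT => /eqP nz; apply: sq0; exists l'.
exists l; rewrite rl; pose X := kermx (M l).
have XM u : (u <= X)%MS -> MC l u = 0 by move/sub_kermxP; apply: kerP.
rewrite -[span_mx _]/(span_mx (MC l)).
apply: leq_trans (rank_span_le (MCsym l) XM (full X)) _.
(* The complement has rank exactly [s], so the bound leaves no room for squares. *)
rewrite big1 ?addn0 ?rkC ?mxrank_ker ?rl ?subKn // => i _.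
set u := row i _.
have /row_free_pencil-/(_ (rowsub (maxrankfun (M l)) (M u)))[q q0 qP] :=
  maxrowsub_free (M l).
have [|t] := Kinf (q := 'X * q); first by rewrite mulf_neq0 ?polyX_eq0.
rewrite rootM negb_or rootX => /andP[t0 /qP free].
(* The perturbed form still has maximal rank, so its square is zero. Expanded modulo the row space
   of [M l], this square reduces to [t * t] times the square of [u]. *)
have /sq0 : \rank (M (l + t *: u)) = s.
  apply/eqP; rewrite eqn_leq smax /= -rl.
  move: free => /eqP <-; apply: mxrankS; rewrite rowsub_linear.
  by apply/row_subP=> j; rewrite row_rowsub row_sub.
set C := cokermx (M l).
have uMlC : u *m M l *m C = 0 by rewrite -mulmxA mulmx_coker mulmx0.
have lMuC : l *m M u *m C = 0 by rewrite Msym.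
move/(congr1 (mulmx^~ C)); rewrite mul0mx linearD linearZ /=.
rewrite mulmxDl !mulmxDr -!scalemxAl -!scalemxAr !mulmxDl -!scalemxAl.
rewrite uMlC lMuC sq0 // mul0mx !scaler0 !add0r scalerA => /eqP.
by rewrite scaler_eq0 mulf_eq0 (negPf t0) /= mulmxA => /eqP->; rewrite mxrank0.
Qed.


End Exists.

Lemma reduction_number_one N d r (M : {linear 'rV[K]_N -> 'M[K]_(N, d)}) :
  (forall u v, u *m M v = v *m M u) -> (\rank (span_mx M) < 'C(r + 2, r))%N ->
  exists v : 'I_r -> 'rV_N, (span_mx M <= \sum_i <<M (v i)>>)%MS.
Proof.
have binE n : 'C(n + 2, n) = 'C(n.+2, 2).
  by have := bin_sub (leq_addl n 2); rewrite addnK addn2.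
elim: r M => [|r IHr] M Msym.
  rewrite bin0 ltnS leqn0 mxrank_eq0 => /eqP->.
  by exists (fun=> 0); rewrite sub0mx.
rewrite binE => rkM.
have [l rkl] := exists_rank_coker_le Msym.
set C := cokermx (M l) in rkl.
have [||v vP] := IHr (mulmxr C \o M).
- by move=> u v /=; rewrite !mulmxA Msym.
- rewrite -[span_mx _]/(span_mx (fun v => M v *m C)).
  rewrite binE.
  have := rank_span_coker M l; rewrite -/C.
  rewrite 2!(binS _ 1) !bin1 in rkM *.
  (* Let [s] be the rank of [M l]. If [s <= r + 1], the bound ['C(s, 2)] is small enough. Otherwise,
     dividing by [l V] removes at least [r + 2 = 'C(r + 3, 2) - 'C(r + 2, 2)] dimensions. *)
  case: (leqP (\rank (M l)) r.+1) => [le_r|]; last by lia.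
  by have := leq_bin2l 2 le_r; lia.
exists (fun i => if unlift ord0 i is Some j then v j else l).
rewrite big_ord_recl unlift_none.
under eq_bigr do rewrite liftK.
apply/sumsmx_subP=> i _; rewrite genmxE.
set e := delta_mx 0 i; set T := (\sum_(j < r) _)%MS.
have /submxP[D MeC] : (M e *m C <= T *m C)%MS.
  apply: submx_trans (span_mx_sub (mulmxr C \o M) e) _.
  apply: submx_trans vP _; apply/sumsmx_subP=> j _; rewrite genmxE /= submxMr //.
  by rewrite (sumsmx_sup j) // genmxE.
(* Modulo [l V] the rows of [M e] come from [T]; the difference is killed by [C], hence lies in the
   row space of [M l]. *)
rewrite -(subrK (D *m T) (M e)); apply: addmx_sub_adds; last exact: submxMl.
by rewrite genmxE submxE mulmxBl MeC mulmxA subrr.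
Qed.

End Quadratic.

(** * Dimension of spanned modules *)

(** An alias that carries the proof of invertibility, so that a field structure can be attached to
    the residue ring. *)
Definition field_of (A : comNzRingType)
  (_ : forall x : A, x != 0 -> exists y, y * x = 1) : Type := A.

Section FieldOf.
Variables (A : comNzRingType) (A_field : forall x : A, x != 0 -> exists y, y * x = 1).

HB.instance Definition _ := GRing.ComNzRing.on (field_of A_field).

Definition field_of_inv (x : field_of A_field) : field_of A_field :=
  xget 0 [set y | y * x = 1].

Lemma field_of_mulVf x : x != 0 -> field_of_inv x * x = 1.
Proof. by move=> /A_field; apply: xgetPex. Qed.

Lemma field_of_inv0 : field_of_inv 0 = 0.
Proof.
by apply: xgetPN => y; rewrite /= mulr0 => /esym/eqP; rewrite oner_eq0.
Qed.

HB.instance Definition _ :=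
  GRing.ComNzRing_isField.Build (field_of A_field) field_of_mulVf field_of_inv0.
End FieldOf.

Lemma spanned_dim_le (K : fieldType) (V : lmodType K) p n (v : 'I_n -> V) :
  Vector.axiom p V -> (forall x, exists c : 'I_n -> K, x = \sum_i c i *: v i) ->
  (p <= n)%N.
Proof.
case=> f flin [g fK gK] spanV.
pose F : {linear V -> 'rV_p} := HB.pack f (GRing.isLinear.Build K V 'rV_p _ f flin).
suff /eqP <- : row_full (\matrix_i f (v i)) by apply: rank_leq_row.
rewrite -sub1mx; apply/row_subP=> i; have [c cP] := spanV (g (row i 1%:M)).
rewrite -[row i _]gK cP -[f _]/(F _) linear_sum summx_sub // => j _.
by rewrite linearZ scalemx_sub //= -[f (v j)](rowK (fun j => f (v j))) row_sub.
Qed.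

(** A nontrivial relation allows one spanning vector to be dropped. Without any relation, the map
    from coefficients to combinations is bijective and its inverse gives coordinates. *)
Lemma spanned_axiom (K : fieldType) (V : lmodType K) n (v : 'I_n -> V) :
  (forall x, exists c : 'I_n -> K, x = \sum_i c i *: v i) ->
  exists p, inhabited (Vector.axiom p V).
Proof.
elim: n v => [|n IHn] v spanV.
  exists 0%N; constructor; exists (fun=> 0) => [a x y|]; first by rewrite scaler0 addr0.
  exists (fun=> 0) => x; last by rewrite thinmx0.
  by have [c ->] := spanV x; rewrite big_ord0.
have [[c [i ci0 cv0]]|free] :=
  pselect (exists c : 'I_n.+1 -> K, exists2 i, c i != 0 & \sum_j c j *: v j = 0).
  apply: (IHn (fun j => v (lift i j))) => x; have [a ->] := spanV x.
  exists (fun j => a (lift i j) - a i / c i * c (lift i j)).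
  have := congr1 ( *:%R (a i / c i)) cv0.
  rewrite scaler0 !(bigD1_ord i) //= scalerDr scalerA divfK // => /(canRL (addrK _)).
  rewrite sub0r => ->; rewrite addrC scaler_sumr -sumrB.
  by apply: eq_bigr => j _; rewrite scalerBl scalerA.
exists n.+1; constructor.
pose g (c : 'rV[K]_n.+1) := \sum_j c 0 j *: v j.
have gD a x y : g (a *: x + y) = a *: g x + g y.
  rewrite scaler_sumr -big_split; apply: eq_bigr => j _.
  by rewrite !mxE scalerDl scalerA.
have g_inj : injective g.
  move=> x y gxy; apply/rowP=> i; apply: contrapT => /eqP xy; apply: free.
  exists (fun j => x 0 j - y 0 j), i; first by rewrite subr_eq0.
  by under eq_bigr do rewrite scalerBl; rewrite sumrB; apply/eqP; rewrite subr_eq0; apply/eqP.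
have [f gK] : {f | cancel f g}.
  apply: cid; have /choice[f fP] : forall x, exists c, g c = x.
    move=> x; have [c ->] := spanV x; exists (\row_j c j).
    by apply: eq_bigr => j _; rewrite mxE.
  by exists f.
have fK : cancel g f by move=> x; apply: g_inj; rewrite gK.
exists f; last by exists g.
by move=> a x y; apply: g_inj; rewrite gD !gK.
Qed.

(** * Ideals *)

Lemma idealr_of_prop (R : comNzRingType) (P : R -> Prop) :
  P 0 -> ~ P 1 -> (forall c x y, P x -> P y -> P (c * x + y)) ->
  exists I : idealr R, forall x, x \in I <-> P x.
Proof.
move=> P0 P1 PD; pose S : {pred R} := fun x => `[< P x >].
have Scl : idealr_closed S.
  split; [exact/asboolP|exact/asboolP|].
  by move=> c x y /asboolP Px /asboolP Py; apply/asboolP/PD.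
pose I : idealr R := HB.pack S (isIdealr.Build R S Scl).
by exists I => x; split=> [/asboolP|?]; last exact/asboolP.
Qed.

Lemma mem_generator (R : comNzRingType) (I : idealr R) n (z : 'I_n -> R) :
  (forall y, y \in I <-> exists a : 'I_n -> R, y = \sum_i a i * z i) ->
  forall i, z i \in I.
Proof.
move=> zP i; apply/zP; exists (fun j => (j == i)%:R).
rewrite (bigD1 i) //= eqxx mul1r big1 ?addr0 // => j /negPf->.
by rewrite mul0r.
Qed.

(** * Local and standard graded rings *)

Section Local.
Variables (R : comNzRingType) (m : idealr R).
Hypothesis m_local : local_at m.

(** A nonunit generates a proper ideal, which Zorn's lemma enlarges to a maximal ideal; by locality
    this is [m]. *)
Lemma local_unit a : a \notin m -> exists b, b * a = 1.
Proof.
move=> nma; apply: contrapT => nunit.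
have [Ia IaP] : exists I : idealr R, forall x, x \in I <-> exists c, x = c * a.
  apply: idealr_of_prop.
  - by exists 0; rewrite mul0r.
  - by case=> b b1; apply: nunit; exists b.
  - by move=> c _ _ [b ->] [d ->]; exists (c * b + d); rewrite mulrDl mulrA.
have aIa : a \in Ia by apply/IaP; exists 1; rewrite mul1r.
(* Ordering [idealr R] itself would be a universe inconsistency. *)
pose T := {S : R -> bool | exists2 I : idealr R, I =i S & a \in I}.
pose le : rel T := fun I J => `[< {subset sval I <= sval J} >].
have TI (I : T) : exists J : idealr R, J =i sval I by case: (svalP I) => J; exists J.
have inT (I : idealr R) (aI : a \in I) : exists J : T, I =i sval J.
  by exists (exist _ (fun x => x \in I) (ex_intro2 _ _ I (fun=> erefl) aI)).
have [Ta _] := inT _ aIa.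
have [||A Atot|J Jmax] := @ZL_preorder T Ta le.
- by move=> I; apply/asboolP.
- by move=> J I K /asboolP IJ /asboolP JK; apply/asboolP=> x /IJ/JK.
(* A nonempty chain is bounded by its union, the empty one by the principal ideal of [a]. *)
- have [[I0 AI0]|A0] := pselect (exists I, A I); last first.
    by exists Ta => s As; case: A0; exists s.
  have [U UP] : exists U : idealr R,
      forall x, x \in U <-> exists2 I : T, A I & x \in sval I.
    apply: idealr_of_prop.
    + by exists I0 => //; have [K <-] := TI I0; apply: rpred0.
    + by case=> I _; have [K <-] := TI I; rewrite idealr1.
    + move=> c x y [I AI Ix] [J AJ Jy].
      have [/asboolP IJ|/asboolP JI] := Atot _ _ AI AJ.
        exists J => //; have [K KJ] := TI J; rewrite -KJ.
        by apply: rpredD; [apply: idealMr; rewrite KJ IJ|rewrite KJ].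
      exists I => //; have [K KI] := TI I; rewrite -KI.
      by apply: rpredD; [apply: idealMr; rewrite KI|rewrite KI JI].
  have [|TU UTU] := inT U.
    apply/UP; exists I0 => //; by case: (svalP I0) => K KI0; rewrite KI0.
  exists TU => I AI; apply/asboolP => x Ix; rewrite -UTU; apply/UP.
  by exists I.
have [K KJ aK] := svalP J.
have : maximal_ideal K.
  move=> I KI x; apply/idP/idP; last exact: KI.
  have [TI' ITI'] := inT I (KI _ aK).
  have /asboolP JI : le J TI' by apply/asboolP => y; rewrite -KJ -ITI'; apply: KI.
  by have /asboolP := Jmax TI' (asboolT JI); rewrite KJ ITI'; apply.
by move/m_local.2/(_ a); rewrite aK (negPf nma).
Qed.
End Local.

(** * Homogeneous components and degrees *)

Section Decomp.
Variables (R : comNzRingType) (G : std_grading R).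

(** [f] lists the homogeneous components of [x]. Asking for all large cutoffs [p] makes [f]
    eventually zero and lets several elements share one cutoff. *)
Definition decomp (x : R) (f : nat -> R) :=
  (forall i, f i \in G i) /\
  exists n, forall p, (n <= p)%N -> x = \sum_(i < p) f i.

Lemma decompP n f : (forall i, f i \in G i) ->
  decomp (\sum_(i < n) f i) (fun i => if (i < n)%N then f i else 0).
Proof.
move=> Gf; split=> [i|]; first by case: ifP => // _; apply: rpred0.
by exists n => p np; rewrite sum_trunc.
Qed.

Lemma decomp_exists x : exists f, decomp x f.
Proof.
have [n [f [Gf ->]]] := piece_span G x.
by eexists; apply: decompP Gf.
Qed.

Lemma decomp_unique x f g : decomp x f -> decomp x g -> f =1 g.
Proof.
move=> [Gf [n fP]] [Gg [p gP]] i; apply/eqP; rewrite -subr_eq0; apply/eqP.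
apply: (piece_free (n := (n + p + i).+1) (f := fun i => f i - g i)) => //.
  by move=> j; apply: rpredB.
  by rewrite sumrB -fP -?gP ?subrr //; lia.
by lia.
Qed.

Lemma decompD x y f g :
  decomp x f -> decomp y g -> decomp (x + y) (fun i => f i + g i).
Proof.
move=> [Gf [n fP]] [Gg [p gP]]; split=> [i|]; first exact: rpredD.
by exists (n + p)%N => q qP; rewrite big_split -fP -?gP //; lia.
Qed.

Lemma decomp0 : decomp 0 (fun=> 0).
Proof. by split=> [i|]; [apply: rpred0 | exists 0%N => p _; rewrite big1]. Qed.

Lemma decomp_piece i x : x \in G i -> decomp x (fun j => if j == i then x else 0).
Proof.
move=> Gx; split=> [j|]; first by case: eqP => [->|] // _; apply: rpred0.
exists i.+1 => p ip; rewrite (bigD1 (Ordinal ip)) //= eqxx big1 ?addr0 // => j.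
by rewrite -val_eqE /= => /negPf->.
Qed.

Lemma decompM1 x f y :
  decomp x f -> y \in G 1 -> decomp (x * y) (fun i => if i is j.+1 then f j * y else 0).
Proof.
move=> [Gf [n fP]] Gy; split=> [[|i]|]; first exact: rpred0.
  by rewrite -addn1 pieceM.
exists n.+1 => -[//|p] np; rewrite big_ord_recl add0r (fP p) // mulr_suml.
exact: eq_bigr.
Qed.

Definition deg_ge q (x : R) :=
  exists2 f, decomp x f & forall i, (i < q)%N -> f i = 0.

Lemma deg_ge0 q : deg_ge q 0. Proof. by exists (fun=> 0) => //; apply: decomp0. Qed.

Lemma deg_geD q x y : deg_ge q x -> deg_ge q y -> deg_ge q (x + y).
Proof.
move=> [f df f0] [g dg g0]; exists (fun i => f i + g i); first exact: decompD.
by move=> i iq; rewrite f0 ?g0 ?addr0.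
Qed.

Lemma deg_ge_piece q i x : x \in G i -> (q <= i)%N -> deg_ge q x.
Proof.
move=> Gx qi; eexists; first exact: decomp_piece Gx.
by move=> j jq /=; case: eqP => // ji; lia.
Qed.

Lemma deg_geM q x y : x \in irrelevant G -> deg_ge q y -> deg_ge q.+1 (x * y).
Proof.
move=> /asboolP[n [f [Gf ->]]] [g [Gg [p /(_ p (leqnn p)) ->]] g0].
rewrite mulr_suml; elim/big_ind: _ => [||i _]; [exact: deg_ge0|exact: deg_geD|].
rewrite mulr_sumr; elim/big_ind: _ => [||j _]; [exact: deg_ge0|exact: deg_geD|].
have [/g0 ->|qj] := ltnP j q; first by rewrite mulr0; apply: deg_ge0.
by apply: deg_ge_piece (pieceM (Gf i) (Gg j)) _; lia.
Qed.

Lemma piece0_irrelevant x : x \in G 0 -> x \in irrelevant G -> x = 0.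
Proof.
move=> Gx mx; pose f i := if i is 0%N then x else 0.
apply: (irrelevantP0 (G := G) (n := 0) (f := f)); last by rewrite big_ord1.
by case=> [|i] /=; rewrite ?rpred0.
Qed.

Lemma sub_piece0 x : exists2 a, a \in G 0 & x - a \in irrelevant G.
Proof.
have [f [Gf [n fP]]] := decomp_exists x; exists (f 0%N) => //.
rewrite (fP n.+1) // big_ord_recl addrC addKr.
by apply: rpred_sum => i _; apply: (@irrelevant_piece _ _ i).
Qed.

(** Since [R] is generated by degrees 0 and 1, the subring [R_0 + R_1 + m^2] is all of [R]; for [x]
    in [m] the part in [R_0] vanishes. *)
Lemma sub_piece1 x : x \in irrelevant G ->
  exists2 b, b \in G 1 & x - b \in idealM (irrelevant G) (irrelevant G).
Proof.
set m := (irrelevant G : {pred R}); set m2 := idealM _ _ => mx.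
have G1m b : b \in G 1 -> b \in irrelevant G by apply: irrelevant_piece.
pose P x := exists a b, [/\ a \in G 0, b \in G 1 & x - (a + b) \in m2].
pose S : {pred R} := fun x => `[< P x >].
have Scl : GRing.subring_closed S.
  split.
  - by apply/asboolP; exists 1, 0; rewrite piece_one !rpred0 addr0 subrr rpred0.
  - move=> y z /asboolP[a [b [Ga Gb yab]]] /asboolP[c [d [Gc Gd zcd]]].
    apply/asboolP; exists (a - c), (b - d); split; [exact: rpredB|exact: rpredB|].
    have -> : y - z - (a - c + (b - d)) = (y - (a + b)) - (z - (c + d)) by ring.
    exact: rpredB.
  - move=> y z /asboolP[a [b [Ga Gb yab]]] /asboolP[c [d [Gc Gd zcd]]].
    apply/asboolP; exists (a * c), (a * d + c * b); split.
    + exact: (pieceM Ga Gc).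
    + by apply: rpredD; [apply: (pieceM Ga Gd) | apply: (pieceM Gc Gb)].
    + have -> : y * z - (a * c + (a * d + c * b))
        = b * d + ((a + b) * (z - (c + d)) + z * (y - (a + b))) by ring.
      apply: rpredD; last by apply: rpredD; apply: idealMr.
      apply/asboolP; exists 1%N, (fun=> b), (fun=> d).
      by rewrite big_ord1; split=> // _; apply: G1m.
pose SS : subringClosed R := HB.pack S (GRing.isSubringClosed.Build R S Scl).
have /asboolP[a [b [Ga Gb xab]]] : x \in SS.
  apply: (@piece_gen _ G) => y Gy; apply/asboolP.
    by exists y, 0; rewrite addr0 subrr !rpred0.
  by exists 0, y; rewrite add0r subrr !rpred0.
have a0 : a = 0.
  apply: piece0_irrelevant => //.
  have -> : a = x - b - (x - (a + b)) by ring.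
  by apply: rpredB; [apply: rpredB => //; apply: G1m | exact: (idealM_sub xab)].
by exists b => //; rewrite a0 add0r in xab.
Qed.

End Decomp.

(** * Fibers and Nakayama's lemma *)

Section LocalOrGraded.
Variables (R : comNzRingType) (L : local_or_graded R).
Local Notation m := (maxid L).
Local Notation k := (residue_field L).

Lemma pi_eq0 a : \pi_k a = 0 <-> a \in m.
Proof.
rewrite -[a in a \in _]subr0 (Quotient.idealrBE m) -(rmorph0 \pi_k).
by split=> [/eqP|/eqP].
Qed.

(** In the graded case, a representative is congruent modulo [m] to a nonzero element of the field
    [R_0]. *)
Lemma residue_field_inv (x : k) : x != 0 -> exists y, y * x = 1.
Proof.
rewrite -[x]reprK; set a := repr x => /eqP a0.
suff [b ba] : exists b, b * a - 1 \in m.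
  exists (\pi b); rewrite -rmorphM -(rmorph1 \pi_k); apply/eqP.
  by rewrite -subr_eq0 -rmorphB; apply/eqP/pi_eq0.
have {a0} : a \notin m by apply/negP=> /pi_eq0.
rewrite /maxid; case: (L) => [m0 m0P|G] nma.
  by have [b ba] := local_unit m0P nma; exists b; rewrite ba subrr rpred0.
have [c Gc ca] := sub_piece0 G a.
have c0 : c != 0 by apply: contraNneq nma => c0; rewrite c0 subr0 in ca.
have [b Gb cb] := piece0_field Gc c0.
exists b; rewrite -cb mulrC -mulrBl mulrC; exact: idealMr.
Qed.

Definition kfield : fieldType := field_of residue_field_inv.

Lemma idealM_gen (I J : idealr R) n (z : 'I_n -> R) w :
  (forall y, y \in J <-> exists a : 'I_n -> R, y = \sum_i a i * z i) ->
  w \in idealM I J ->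
  exists2 a : 'I_n -> R, forall i, a i \in I & w = \sum_i a i * z i.
Proof.
move=> Jz /asboolP[p [a [b [Ia Jb ->]]]].
have /choice[c bc] : forall j, exists c : 'I_n -> R, b j = \sum_i c i * z i.
  by move=> j; apply/Jz.
exists (fun i => \sum_j a j * c j i) => [i|].
  by apply: rpred_sum => j _; rewrite mulrC; apply: idealMr.
under eq_bigr do rewrite bc mulr_sumr; rewrite exchange_big /=.
by apply: eq_bigr => i _; rewrite mulr_suml; apply: eq_bigr => j _; rewrite mulrA.
Qed.

(** The local case is the determinant trick. In the graded case, iterating [J <= I + m J]
    approximates elements of [J] by elements of [I] up to arbitrarily high degree, and homogeneity
    of [I] concludes. *)
Lemma nakayama (I J : idealr R) : noetherian R -> admissible L I ->
  (forall x, x \in J -> exists2 y, y \in I & x - y \in idealM m J) ->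
  {subset J <= I}.
Proof.
move=> noethR; rewrite /admissible /maxid; case: (L) => [m0 m0P _|G homI] JI.
  have [n [z zP]] := noethR J.
  have zJ i : z i \in J := mem_generator zP i.
  have /choice[y yP] : forall i, exists y, y \in I /\
      exists2 a : 'I_n -> R, forall j, a j \in m0 & z i - y = \sum_j a j * z j.
    move=> i; have [y Iy zy] := JI _ (zJ i); exists y; split=> //.
    exact: idealM_gen zP zy.
  have /choice[a aP] : forall i, exists a : 'I_n -> R,
     (forall j, a j \in m0) /\ z i - y i = \sum_j a j * z j.
    by move=> i; have [_ [a am zy]] := yP i; exists a.
  pose A : 'M[R]_n := 1%:M - \matrix_(i, j) a i j.
  have Az : A *m (\col_i z i) = \col_i y i.
    rewrite mulmxBl mul1mx; apply/colP=> i; rewrite !mxE.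
    rewrite -[y i](subKr (z i)) (aP i).2; congr (_ - _).
    by apply: eq_bigr => j _; rewrite !mxE.
  have [b bA] : exists b, b * \det A = 1.
    (* Modulo [m0] the matrix [A] is the identity, so its determinant is 1 there. *)
    apply: (local_unit m0P); apply/negP => detA.
    pose q : {rmorphism R -> {ideal_quot m0}} := \pi_{ideal_quot m0}.
    have q0 x : x \in m0 -> q x = 0.
      rewrite -[x in x \in _]subr0 (Quotient.idealrBE m0) => /eqP.
      by rewrite -/(q x) -/(q 0) rmorph0.
    have /eqP := q0 _ detA; rewrite -det_map_mx map_mxB map_mx1.
    rewrite (_ : map_mx q _ = 0) ?subr0 ?det1 ?oner_eq0 //.
    by apply/matrixP=> i j; rewrite !mxE q0 ?(aP i).1.
  move=> x /zP[c ->]; apply: rpred_sum => i _; apply: idealMr.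
  have := congr1 (fun Z : 'cV_n => b * (\adj A *m Z) i 0) Az.
  rewrite mulmxA mul_adj_mx mul_scalar_mx !mxE mulrA bA mul1r => ->.
  apply: idealMr; apply: rpred_sum => j _; apply: idealMr.
  by rewrite mxE (yP j).1.
have step q x : x \in J -> exists2 y, y \in I & deg_ge G q (x - y).
  elim: q x => [|q IHq] x Jx.
    by exists 0; rewrite ?rpred0 //; have [f] := decomp_exists G (x - 0); exists f.
  have [y Iy /asboolP[n [a [b [ma Jb xy]]]]] := JI x Jx.
  have /choice[c cP] : forall i, exists c, c \in I /\ deg_ge G q (b i - c).
    by move=> i; have [c Ic bc] := IHq _ (Jb i); exists c.
  exists (y + \sum_i a i * c i).
    by apply: rpredD => //; apply: rpred_sum => i _; apply: idealMr; apply: (cP i).1.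
  rewrite opprD addrA xy -sumrB.
  elim/big_ind: _ => [||i _]; [exact: deg_ge0 | exact: deg_geD |].
  by rewrite -mulrBr; apply: deg_geM (cP i).2.
move=> x Jx; have [f df] := decomp_exists G x.
have [Gf [n fP]] := df; have [y Iy [h [Gh [p hP]] h0]] := step n x Jx.
rewrite (fP n) //; apply: rpred_sum => i _.
(* All components of [x] sit below degree [n], where [x - y] has none; there [f i - h i], a
   component of [y], equals [f i]. *)
have := homI (n + p).+1 (fun i => f i - h i).
rewrite sumrB -fP -?hP; try lia; rewrite subKr => /(_ _ Iy i).
rewrite h0 ?ltn_ord // subr0; apply => [j|]; first exact: rpredB.
by have := ltn_ord i; lia.
Qed.

(** Representatives for [m / m^2]; in the graded case degree 1 is imposed so that they generate
    homogeneous ideals. *)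
Definition linear_form : {pred R} :=
  match L with LocalCase m0 _ => [in m0] | GradedCase G => [in G 1] end.


Lemma linear_form_maxid x : x \in linear_form -> x \in m.
Proof. by rewrite /linear_form /maxid; case: (L) => // G; apply: irrelevant_piece. Qed.

Lemma linear_form_gen : noetherian R ->
  exists n (x : 'I_n -> R), (forall i, x i \in linear_form) /\
    forall y, y \in m -> exists a : 'I_n -> R, y - \sum_i a i * x i \in idealM m m.
Proof.
move=> noethR; have [n [z zP]] := noethR m; exists n.
have zm i : z i \in m := mem_generator zP i.
have /choice[x xP] :
    forall i, exists x, x \in linear_form /\ z i - x \in idealM m m.
  move=> i; move: (zm i); rewrite /linear_form /maxid; case: (L) => [m0 m0P|G] mzi.
    by exists (z i); rewrite subrr rpred0.
  by have [b Gb zb] := sub_piece1 mzi; exists b.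
exists x; split=> [i|y /zP[a ->]]; first by case: (xP i).
exists a; rewrite -sumrB; apply: rpred_sum => i _.
by rewrite -mulrBr; apply: idealMr; case: (xP i).
Qed.

(** In the graded case the coefficients must be lifted to [R_0], so that the combination stays in
    degree 1. *)
Lemma linear_form_comb n (x : 'I_n -> R) (c : 'I_n -> k) :
  (forall i, x i \in linear_form) ->
  exists2 a : 'I_n -> R, forall i, \pi_k (a i) = c i
    & \sum_i a i * x i \in linear_form.
Proof.
move=> Lx.
have [a [ca La]] : exists a : 'I_n -> R, (forall i, repr (c i) - a i \in m) /\
    \sum_i a i * x i \in linear_form.
  suff: forall b : 'I_n -> R, exists a : 'I_n -> R,
      (forall i, b i - a i \in m) /\ \sum_i a i * x i \in linear_form by apply.
  move=> {}c; move: Lx; rewrite /linear_form /maxid.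
  case: (L) => [m0 m0P|G] Lx.
    exists c; split=> [i|]; first by rewrite subrr rpred0.
    by apply: (@rpred_sum _ m0) => i _; apply: idealMr; apply: Lx.
  have /choice[a aP] : forall i, exists a, a \in G 0 /\ c i - a \in irrelevant G.
    by move=> i; have [a] := sub_piece0 G (c i); exists a.
  exists a; split=> [i|]; first by case: (aP i).
  by apply: (@rpred_sum _ (G 1)) => i _; apply: (pieceM (aP i).1 (Lx i)).
exists a => // i; rewrite -[RHS]reprK; apply/esym/eqP.
by rewrite -(Quotient.idealrBE m).
Qed.

Lemma linear_form_ideal n (y : 'I_n -> R) : (forall i, y i \in linear_form) ->
  exists I : idealr R, [/\ forall x, x \in I <-> exists a : 'I_n -> R, x = \sum_i a i * y i,
    admissible L I & {subset I <= m}].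
Proof.
move=> Ly.
have ym x : (exists a : 'I_n -> R, x = \sum_i a i * y i) -> x \in m.
  case=> a ->; apply: rpred_sum => i _; apply: idealMr.
  exact: linear_form_maxid.
have [I IP] : exists I : idealr R,
    forall x, x \in I <-> exists a : 'I_n -> R, x = \sum_i a i * y i.
  apply: idealr_of_prop.
  - by exists (fun=> 0); rewrite big1 // => i _; rewrite mul0r.
  - by move/ym; rewrite idealr1.
  - move=> c _ _ [a ->] [b ->]; exists (fun i => c * a i + b i).
    rewrite mulr_sumr -big_split; apply: eq_bigr => i _ /=.
    by rewrite mulrDl mulrA.
exists I; split=> //; last by move=> x /IP/ym.
have yI i : y i \in I := mem_generator IP i.
move: Ly; rewrite /linear_form /admissible; case: (L) => // G Gy q f Gf /IP[a fa] i iq.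
(* Multiplying by [y j] of degree 1 only shifts the components of [a j], so each component of the
   sum is again in [I]. *)
have [h dh Ih] : exists2 h, decomp G (\sum_(i < q) f i) h & forall i, h i \in I.
  rewrite fa; elim/big_ind: _ => [|u v [g dg Ig] [h dh Ih]|j _].
  - by exists (fun=> 0) => [|j]; [apply: decomp0 | apply: rpred0].
  - by exists (fun i => g i + h i) => [|j]; [apply: decompD | apply: rpredD].
  - have [g dg] := decomp_exists G (a j).
    eexists; first exact: decompM1 dg (Gy j).
    by case=> [|l]; [apply: rpred0 | apply: idealMr].
have := decomp_unique (decompP q Gf) dh i; rewrite iq => ->.
exact: Ih.
Qed.

(** * Coordinates on [I / mI] *)

Section Fiber.
Variable I : idealr R.

(** Elements outside [I] get the junk value 0, hence the membership hypotheses below. *)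
Let elt (x : R) : ideal_elt I := insubd 0 x.

Let eltK x : x \in I -> val (elt x) = x.
Proof. by move=> Ix; rewrite insubdK. Qed.

Lemma fiber_span n (z : 'I_n -> R) :
  (forall y, y \in I <-> exists a : 'I_n -> R, y = \sum_i a i * z i) ->
  forall v : fiber L I, exists c : 'I_n -> k,
    v = \sum_i c i *: (\pi_(fiber L I) (elt (z i)) : fiber L I).
Proof.
move=> zP v.
have zI i : z i \in I := mem_generator zP i.
have /zP[a va] := valP (repr v).
exists (fun i => \pi_k (a i)); rewrite -[v]reprK.
under eq_bigr => i _ do rewrite -[_ *: _]/(fiber_scale _ _) fiber_scaleE.
rewrite -raddf_sum; apply: pi_val.
rewrite -[LHS]/(val (repr v)) -[RHS]/(val _) va raddf_sum; apply: eq_bigr => i _ /=.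
by rewrite -[ideal_val _]/(val _) eltK.
Qed.

(** Finite generation makes the fiber finite-dimensional, so [mu] is a true dimension and not the
    default of [xget]. *)
Lemma mu_axiom : noetherian R -> inhabited (Vector.axiom (mu L I) (fiber L I)).
Proof.
move=> noethR; have [n [z zP]] := noethR I.
have := @spanned_axiom kfield (fiber L I) n _ (fiber_span zP).
exact: xgetPex.
Qed.

Lemma mu_le n (z : 'I_n -> R) : noetherian R ->
  (forall y, y \in I <-> exists a : 'I_n -> R, y = \sum_i a i * z i) ->
  (mu L I <= n)%N.
Proof.
move=> noethR zP; have [ax] := mu_axiom noethR.
exact: (@spanned_dim_le kfield (fiber L I) _ n _ ax (fiber_span zP)).
Qed.

Lemma fiber_coord : noetherian R -> exists theta : R -> 'rV[k]_(mu L I),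
  [/\ {in I &, {morph theta : x y / x + y}},
      forall a x, x \in I -> theta (a * x) = \pi_k a *: theta x
    & forall x, x \in I -> theta x = 0 <-> x \in idealM m I].
Proof.
move=> noethR; have [[f flin fbij]] := mu_axiom noethR.
pose F : {linear fiber L I -> 'rV[k]_(mu L I)} :=
  HB.pack f (GRing.isLinear.Build k (fiber L I) _ _ f flin).
exists (fun x => F (\pi_(fiber L I) (elt x))); split=> [x y Ix Iy|a x Ix|x Ix].
- rewrite -linearD -raddfD; congr (F _); apply: pi_val.
  by rewrite -[LHS]/(val _) -[RHS]/(val _) raddfD /= -![ideal_val _]/(val _) !eltK // rpredD.
- rewrite -linearZ /= -[_ *: _]/(fiber_scale _ _) fiber_scaleE; congr (F _).
  by apply: pi_val; rewrite /= -![ideal_val _]/(val _) !eltK // idealMr.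
have -> : x \in idealM m I <-> \pi_(fiber L I) (elt x) = 0.
  by rewrite -(raddf0 \pi_(fiber L I)) fiber_eq [val 0]raddf0 subr0 eltK.
split=> [|->]; last exact: linear0.
by rewrite -(linear0 F) => /(bij_inj fbij).
Qed.

End Fiber.

End LocalOrGraded.

(** * The theorem of Eakin and Sathaye for m^2 *)

Lemma infinite_nonroot (K : fieldType) : infinite_set [set: K] ->
  forall q : {poly K}, q != 0 -> exists t, ~~ root q t.
Proof.
move=> Kinf q q0; have [B _ sB] := infinite_set_fset (size q) Kinf.
apply: contrapT => allroot; suff: (size (finmap.enum_fset B) < size q)%N by rewrite ltnNge sB.
apply: max_poly_roots => //; last exact: finmap.fset_uniq.
by apply/allP => t _; apply: contraT => qt; case: allroot; exists t.
Qed.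

Section Main.
Variables (R : comNzRingType) (L : local_or_graded R).
Hypotheses (noethR : noetherian R) (k_infinite : infinite_set [set: residue_field L]).
Local Notation m := (maxid L).
Local Notation k := (residue_field L).
Local Notation m2 := (idealM m m).
Local Notation K := (kfield L).

Lemma exists_reduction r : (mu L m2 < 'C(r + 2, r))%N ->
  exists I : idealr R,
    [/\ admissible L I, {subset I <= m}, {subset m2 <= I} & (mu L I <= r)%N].
Proof.
move=> mu_lt; have [theta [thD thZ thK]] := fiber_coord L m2 noethR.
have th0 : theta 0 = 0 by apply/(thK _ (rpred0 _)); apply: rpred0.
have th_sum n (F : 'I_n -> R) : (forall i, F i \in m2) ->
    theta (\sum_i F i) = \sum_i theta (F i).
  move=> Fm2; suff [] : \sum_i F i \in m2 /\ theta (\sum_i F i) = \sum_i theta (F i) by [].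
  apply: (big_rec2 (fun a b => a \in m2 /\ theta a = b)).
    by rewrite rpred0.
  by move=> i a b _ [am2 <-]; rewrite rpredD ?thD ?Fm2.
have th_eq x y : x \in m2 -> y \in m2 -> theta x = theta y -> x - y \in idealM m m2.
  move=> xm2 ym2 xy; apply/(thK (x - y) (rpredB xm2 ym2)).
  by rewrite -mulN1r thD ?thZ ?idealMr // xy rmorphN1 scaleN1r subrr.
have [N [x [Lx xgen]]] := linear_form_gen L noethR.
have xm i : x i \in m by apply: linear_form_maxid.
have mm2 a b : a \in m -> b \in m -> a * b \in m2.
  by move=> am bm; apply/asboolP; exists 1%N, (fun=> a), (fun=> b); rewrite big_ord1.
(* Row [j] holds the coordinates in [m^2 / m^3] of [x j] times the linear form with coefficients
   [v]. *)
pose f (v : 'rV[K]_N) : 'M[K]_(N, mu L m2) :=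
  \matrix_j (\sum_i v 0 i *: theta (x i * x j)).
have flin : linear f.
  move=> a u v; apply/row_matrixP=> j; rewrite linearD linearZ /= !rowK scaler_sumr.
  rewrite -big_split; apply: eq_bigr => i _.
  by rewrite !mxE scalerDl scalerA.
pose M : {linear 'rV[K]_N -> 'M[K]_(N, mu L m2)} :=
  HB.pack f (GRing.isLinear.Build K _ _ _ f flin).
have ME u v : u *m M v = \sum_j \sum_i (u 0 j * v 0 i) *: theta (x i * x j).
  rewrite mulmx_sum_row; apply: eq_bigr => j _; rewrite rowK scaler_sumr.
  by apply: eq_bigr => i _; rewrite scalerA.
have Msym u v : u *m M v = v *m M u.
  rewrite !ME exchange_big; apply: eq_bigr => i _; apply: eq_bigr => j _.
  by rewrite mulrC [x j * _]mulrC.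
have [|v vP] := reduction_number_one (infinite_nonroot (K := K) k_infinite) (r := r) Msym.
  exact: leq_ltn_trans (rank_leq_col _) mu_lt.
have /choice[a aP] : forall l, exists a : 'I_N -> R,
    (forall i, \pi_k (a i) = v l 0 i) /\ \sum_i a i * x i \in linear_form L.
  by move=> l; have [a] := linear_form_comb (fun i => v l 0 i) Lx; exists a.
pose y l := \sum_i a l i * x i.
have [I [IP homI Im]] := linear_form_ideal (y := y) (fun l => (aP l).2).
exists I; split=> //; last exact: mu_le noethR IP.
(* [P] is membership in [I + m^3]. It is stable under sums and multiples, so it need only be checked
   on the products [x i * x j]. *)
pose P z := exists2 w, w \in I & z - w \in idealM m m2.
have P0 : P 0 by exists 0; rewrite ?subrr rpred0.
have PD z w : P z -> P w -> P (z + w).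
  move=> [z' Iz zz'] [w' Iw ww']; exists (z' + w'); first exact: rpredD.
  by rewrite opprD addrACA rpredD.
have PM c z : P z -> P (c * z).
  move=> [z' Iz zz']; exists (c * z'); first exact: idealMr.
  by rewrite -mulrBr idealMr.
have Px i j : P (x i * x j).
  have : ((theta (x i * x j)%R : 'rV[K]_(mu L m2)) <= \sum_l <<M (v l)>>)%MS.
    apply: submx_trans vP; apply: submx_trans (span_mx_sub M (delta_mx 0 i)).
    have -> : theta (x i * x j) = delta_mx 0 j *m M (delta_mx 0 i).
      rewrite -rowE rowK (bigD1 i) //= mxE !eqxx scale1r big1 ?addr0 // => l li.
      by rewrite mxE eqxx (negPf li) scale0r.
    exact: submxMl.
  case/sub_sumsmxP=> u thE.
  have /choice[w wP] : forall l, exists w, u l *m <<M (v l)>>%MS = w *m M (v l).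
    move=> l; apply/submxP; apply: submx_trans (submxMl _ _) _.
    by rewrite genmxE.
  (* The coefficients [w l] over the residue field are lifted to [R], which turns the relation among
     coordinates into a congruence modulo [m^3]. *)
  pose z := \sum_l (\sum_j repr (w l 0 j) * x j) * y l.
  have ym l : y l \in m by apply: linear_form_maxid; apply: (aP l).2.
  have zm l : (\sum_j repr (w l 0 j) * x j) * y l \in m2.
    by apply: mm2 => //; apply: rpred_sum => j' _; apply: idealMr.
  exists z; first by apply/IP; eexists.
  apply: th_eq; [exact: mm2|exact: rpred_sum|].
  rewrite thE th_sum //; apply: eq_bigr => l _; rewrite wP ME mulr_suml th_sum.
    apply: eq_bigr => j' _; rewrite -mulrA thZ ?mm2 // reprK.
    rewrite mulr_sumr th_sum => [|i']; last by rewrite mulrCA idealMr ?mm2.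
    rewrite scaler_sumr; apply: eq_bigr => i' _.
    by rewrite mulrCA (thZ (a l i')) ?mm2 // (aP l).1 [x j' * _]mulrC scalerA.
  by move=> j'; rewrite -mulrA idealMr ?mm2.
apply: (nakayama noethR homI) => z /asboolP[n [p [q [pm qm ->]]]].
apply: (big_ind P) => [||i _]; [exact: P0|exact: PD|].
have [b pb] := xgen _ (pm i); have [c qc] := xgen _ (qm i).
set p' := \sum_j _ in pb; set q' := \sum_j _ in qc.
(* Both correction terms lie in [m * m^2], so the factors may be replaced by combinations of the
   [x j]. *)
have -> : p i * q i = p' * q' + (p' * (q i - q') + q i * (p i - p')) by ring.
apply: (PD).
  rewrite mulr_suml; apply: (big_ind P) => [||j _]; [exact: P0|exact: PD|].
  rewrite mulr_sumr; apply: (big_ind P) => [||l _]; [exact: P0|exact: PD|].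
  by rewrite mulrACA; apply: PM.
exists 0; first exact: rpred0.
rewrite subr0; apply: rpredD; apply: idealM_in => //.
by apply: rpred_sum => j _; apply: idealMr.
Qed.

(** Here [I = mI], so Nakayama's lemma against the zero ideal gives [I = 0]. *)
Lemma mu_eq0 (I : idealr R) x : mu L I = 0%N -> x \in I -> x = 0.
Proof.
move=> mu0 Ix; have [theta [_ _ thK]] := fiber_coord L I noethR.
have [O OP] : exists O : idealr R, forall y, y \in O <-> y = 0.
  apply: idealr_of_prop => [//||c y z -> ->]; last by rewrite mulr0 addr0.
  exact/eqP/oner_neq0.
apply/OP; apply: (nakayama (L := L) (J := I) noethR) Ix => [|y Iy].
  rewrite /admissible; case: (L) => // G n f Gf /OP f0 i ni.
  by apply/OP/(piece_free Gf f0).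
exists 0; first exact: rpred0.
by rewrite subr0; apply/(thK _ Iy); apply/rowP=> i; have := ltn_ord i; rewrite [ltnRHS]mu0.
Qed.

End Main.

Local Close Scope quotient_scope.
Local Close Scope ring_scope.

Theorem proposition3p10 (R : comNzRingType) (L : local_or_graded R)
    (noethR : noetherian R)
    (k_infinite : infinite_set [set: residue_field L])
    (m2_neq0 : exists2 x : R, x \in idealM (maxid L) (maxid L) & x != 0%R) :
  (forall r : nat,
     mu L (idealM (maxid L) (maxid L)) < 'C(r + 2, r) -> ms L <= r) /\
  (mu L (idealM (maxid L) (maxid L)) <= 2 -> ms L = 1).
Proof.
have ms_le r : (mu L (idealM (maxid L) (maxid L)) < 'C(r + 2, r))%N -> (ms L <= r)%N.
  move=> /(exists_reduction noethR k_infinite)[I [homI Im m2I Ir]].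
  apply: leq_trans Ir; rewrite /ms; case: ex_minnP => n _; apply.
  by apply/asboolP; exists I.
(* The upper bound is the case [r = 1], where ['C(3, 1) = 3]. If [ms L] were 0, some ideal
   containing [m^2] would be zero, contrary to [m2_neq0]. *)
split=> // mu2; apply/eqP; rewrite eqn_leq ms_le //= lt0n; apply/negP=> /eqP.
rewrite /ms; case: ex_minnP => n /asboolP[I [_ _ m2I ->]] _ mu0.
have [x m2x] := m2_neq0.
by rewrite (mu_eq0 noethR mu0 (m2I _ m2x)) eqxx.
Qed.
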